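(* Let $\mathcal{R}=(Sen,Mod,\models)$ be a satisfaction system with conjunction, $\kappa:Sen\to Sen$ a retraction, $T\subseteq Sen$ a knowledge base and $\varphi\in Sen$ a sentence such that $T\cup\{\varphi\}$ is consistent. Then the sets $$\mathcal{C}_{lcr}=\{Mod(\kappa^k(\textstyle\bigwedge T)\wedge\varphi)\mid k\in\mathbb{N},\ Mod(\kappa^k(\bigwedge T)\wedge\varphi)\neq Triv\}$$ and $$\mathcal{C}_{lnr}=\{Mod(\kappa^k(\textstyle\bigwedge T\wedge\varphi))\mid k\in\mathbb{N},\ Mod(\kappa^k(\bigwedge T\wedge\varphi))\neq Triv\}$$ are both cuttings for $T$ and $\varphi$.
   Context: A satisfaction system $\mathcal{R}=(Sen,Mod,\models)$ consists of a set $Sen$ of sentences, a class $Mod$ of models, and a relation $\models\,\subseteq Mod\times Sen$. For $T\subseteq Sen$, $Mod(T)=\{\mathcal{M}\in Mod\mid \forall\varphi\in T,\ \mathcal{M}\models\varphi\}$ and $Mod(\varphi)=Mod(\{\varphi\})$. $Triv=\{\mathcal{M}\in Mod\mid \forall\varphi\in Sen,\ \mathcal{M}\models\varphi\}$. A set of sentences $T$ is consistent iff $Mod(T)\neq Triv$. A knowledge base (KB) is a finite set of sentences. $\mathcal{R}$ has conjunction if for any $\varphi_1,\varphi_2\in Sen$ there is a sentence $\varphi_1\wedge\varphi_2$ with $Mod(\varphi_1\wedge\varphi_2)=Mod(\varphi_1)\cap Mod(\varphi_2)$; $\bigwedge T=\varphi_1\wedge\dots\wedge\varphi_n$ for $T=\{\varphi_1,\dots,\varphi_n\}$.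 Cutting: a cutting for a KB $T$ and a formula $\varphi$ is a set $\mathcal{C}\subseteq\mathcal{P}(Mod(T\cup\{\varphi\}))$ such that: $Triv\subsetneq\mathbb{M}$ for every $\mathbb{M}\in\mathcal{C}$; $\mathcal{C}$ is closed under set-theoretical union (of non-empty subfamilies); $Mod(T\cup\{\varphi\})\in\mathcal{C}$; and the poset $(\mathcal{C},\subseteq)$ is well-founded (every non-empty subset has a minimal element). Retraction: a mapping $\kappa:Sen\to Sen$ such that for every $\varphi\in Sen$ that is not a tautology (i.e. $Mod(\varphi)\neq Mod$): (anti-extensivity) $Mod(\kappa(\varphi))\subseteq Mod(\varphi)$; (vacuum) there is $k\in\mathbb{N}$ with $Mod(\kappa^k(\varphi))=Triv$, where $\kappa^0$ is the identity and $\kappa^k(\varphi)=\kappa(\kappa^{k-1}(\varphi))$ for $k>0$. *)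

(* Defs.v *)
From Stdlib Require List.
From mathcomp Require Import all_boot.
From mathcomp Require Import boolp classical_sets functions cardinality.

Set Implicit Arguments.
Unset Strict Implicit.
Unset Printing Implicit Defensive.

Local Open Scope classical_set_scope.

Record satisfaction_system := SatisfactionSystem {
  sentence : Type;
  model : Type;
  satisfies : model -> sentence -> Prop }.

Section SatisfactionSystem.
Variable R : satisfaction_system.
Local Notation Sen := (sentence R).

Definition Mods (T : set Sen) : set (model R) :=
  [set M | forall s, T s -> satisfies M s].

Definition Mods1 (s : Sen) : set (model R) := Mods [set s].

Definition Triv : set (model R) := [set M | forall s, satisfies M s].

Definition consistent (T : set Sen) : Prop := Mods T <> Triv.

Definition tautology (s : Sen) : Prop := Mods1 s = setT.

Definition knowledge_base (T : set Sen) : Prop := finite_set T.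

Definition is_conjunction (conj : Sen -> Sen -> Sen) : Prop :=
  forall s1 s2, Mods1 (conj s1 s2) = Mods1 s1 `&` Mods1 s2.

(* [is_bigconj conj T t]: t is the conjunction s1 /\ ... /\ sn (associated to
   the left) for some enumeration s1, ..., sn of T. It is a relation because
   the sentence depends on the enumeration, and a retraction need not respect
   semantic equivalence. By the usual convention, an empty conjunction is a
   tautology; a satisfaction system may have none. *)
Definition is_bigconj (conj : Sen -> Sen -> Sen) (T : set Sen) (t : Sen) : Prop :=
  exists2 l : seq Sen, T = [set s | List.In s l] &
    match l with
    | [::] => tautology t
    | s :: l' => t = foldl conj s l'
    end.

Record cutting (T : set Sen) (phi : Sen) (C : set (set (model R))) : Prop := {
  cutting_sub : forall M, C M -> M `<=` Mods (T `|` [set phi]);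
  cutting_Triv : forall M, C M -> Triv `<` M;
  cutting_bigcup : forall F : set (set (model R)),
    F `<=` C -> F !=set0 -> C (\bigcup_(M in F) M);
  cutting_top : C (Mods (T `|` [set phi]));
  cutting_wf : forall D : set (set (model R)),
    D `<=` C -> D !=set0 ->
    exists2 M, D M & forall N, D N -> N `<=` M -> N = M }.

Definition retraction (kappa : Sen -> Sen) : Prop :=
  forall s, ~ tautology s ->
    Mods1 (kappa s) `<=` Mods1 s /\
    exists k : nat, Mods1 (iter k kappa s) = Triv.

(* In the next two definitions t stands for the conjunction of the sentences
   of a knowledge base. *)
Definition C_lcr (conj : Sen -> Sen -> Sen) (kappa : Sen -> Sen) (t phi : Sen) :
    set (set (model R)) :=
  [set M | exists2 k : nat, Mods1 (conj (iter k kappa t) phi) <> Triv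
                          & M = Mods1 (conj (iter k kappa t) phi)].

Definition C_lnr (conj : Sen -> Sen -> Sen) (kappa : Sen -> Sen) (t phi : Sen) :
    set (set (model R)) :=
  [set M | exists2 k : nat, Mods1 (iter k kappa (conj t phi)) <> Triv
                          & M = Mods1 (iter k kappa (conj t phi))].

End SatisfactionSystem.

Arguments Triv : clear implicits.

(* Main.v *)
Require Import Defs.
From mathcomp Require Import all_boot.
From mathcomp Require Import boolp classical_sets functions cardinality.

(** Anti-extensivity holds trivially at tautologies too, so the models of
    the iterates of a sentence form a decreasing sequence. It is eventually
    constant: either every iterate is a tautology, or some iterate is not, and
    then vacuum brings the sequence down to the least value [Triv]. A decreasing,
    eventually constant sequence has finitely many values, whence
    well-foundedness, and the union of a subfamily is its member of least
    index. *)

Local Open Scope classical_set_scope.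

Lemma decreasing_bigcup {X : Type} (B : nat -> set X) (F : set (set X)) :
    (forall m n, m <= n -> B n `<=` B m) -> F `<=` range B -> F !=set0 ->
  F (\bigcup_(M in F) M).
Proof.
move=> decB FB [_ /[dup] /FB [k _ <-] Fk].
have exF : exists n, `[< F (B n) >] by exists k; apply/asboolP.
case: (ex_minnP exF) => n /asboolP Fn minn.
suff -> : \bigcup_(M in F) M = B n by [].
apply/seteqP; split=> [x [_ /[dup] /FB [m _ <-] Fm Bx]|x Bx]; last by exists (B n).
by apply: decB Bx; apply: minn; apply/asboolP.
Qed.

(** Past [N] nothing changes, so indices may be capped at [N]; the member of [D] with the largest
    capped index is then the smallest set. *)
Lemma decreasing_stationary_minimal {X : Type} (B : nat -> set X) (N : nat)
    (D : set (set X)) :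
    (forall m n, m <= n -> B n `<=` B m) -> (forall n, N <= n -> B n = B N) ->
    D `<=` range B -> D !=set0 ->
  exists2 M, D M & forall M', D M' -> M' `<=` M -> M' = M.
Proof.
move=> decB statB DB [_ /[dup] /DB [k _ <-] Dk].
(* With truncated subtraction, [N - (N - n)] is the minimum of [n] and [N]. *)
have truncB n : B n = B (N - (N - n)).
  by case: (leqP n N) => [/subKn -> //|/ltnW leNn]; rewrite (eqP leNn) subn0 statB.
(* Counting down from [N] turns the largest capped index into a least [j]. *)
have exD : exists j, `[< D (B (N - j)) >].
  by exists (N - k); apply/asboolP; rewrite -truncB.
case: (ex_minnP exD) => j /asboolP Dj minj; exists (B (N - j)) => //.
move=> _ /[dup] /DB [n _ <-] Dn leB; apply/seteqP; split=> //.
rewrite (truncB n); apply: decB; apply: leq_sub2l; apply: minj.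
by apply/asboolP; rewrite -truncB.
Qed.

Section Retractions.
Context {R : satisfaction_system}.
Implicit Types (s t phi : sentence R) (T : set (sentence R)).

Lemma Mods1E s : Mods1 s = [set M | satisfies M s].
Proof. by apply/seteqP; split=> [M /(_ s erefl)|M Ms _ ->]. Qed.

Lemma Triv_sub_Mods1 s : Triv R `<=` Mods1 s.
Proof. by move=> M MT u _; apply: MT. Qed.

Lemma ModsU1 T phi : Mods (T `|` [set phi]) = Mods T `&` Mods1 phi.
Proof.
apply/seteqP; split=> [M MT|M [MT Mphi] s [/MT//|/Mphi//]].
by split=> s Ts; apply: MT; [left|right].
Qed.

(** The induction on [l] keeps [s] general, because [foldl] replaces the accumulator [s] by
    [conj s u], whose models are the common models of [s] and [u]. *)
Lemma Mods1_foldl_conj conj s (l : seq (sentence R)) : is_conjunction conj ->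
  Mods1 (foldl conj s l) = Mods [set u | List.In u (s :: l)].
Proof.
move=> conjP; elim: l s => [|u l IHl] s /=.
  by rewrite Mods1E; apply/seteqP; split=> [M Ms v [<-|//]|M]; last by apply; left.
rewrite IHl; apply/seteqP; split=> M MT.
  have : Mods1 (conj s u) M by move=> _ ->; apply: MT; left.
  rewrite conjP !Mods1E => -[Ms Mu] v [<-//|[<-//|vl]].
  by apply: MT; right.
move=> v [<-|vl]; last by apply: MT; right; right.
have: Mods1 (conj s u) M; last by rewrite Mods1E.
by rewrite conjP !Mods1E; split; apply: MT; [left|right; left].
Qed.

Lemma Mods1_bigconj conj T t :
  is_conjunction conj -> is_bigconj conj T t -> Mods1 t = Mods T.
Proof.
move=> conjP [[|s l] -> tP]; last by rewrite tP Mods1_foldl_conj.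
by rewrite tP; apply/seteqP; split=> [M _ s []|].
Qed.

(** Common form of both families. Discarding the values equal to [Triv] leaves a subfamily of
    [range B], to which the two lemmas on decreasing sequences apply; consistency keeps [B 0] in
    it. *)
Lemma decreasing_stationary_cutting T phi (B : nat -> set (model R)) (N : nat) :
    (forall m n, m <= n -> B n `<=` B m) -> (forall n, N <= n -> B n = B N) ->
    (forall n, Triv R `<=` B n) ->
    B 0 = Mods (T `|` [set phi]) -> consistent (T `|` [set phi]) ->
  cutting T phi [set M | exists2 k, B k <> Triv R & M = B k].
Proof.
move=> decB statB TrivB B0 consT.
have CB F : F `<=` [set M | exists2 k, B k <> Triv R & M = B k] -> F `<=` range B.
  by move=> FC M /FC [k _ ->]; exists k.
split=> [_ [k _ ->]|_ [k BkT ->]|F FC F0||D DC D0].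
- by rewrite -B0; apply: decB.
- by split=> // BT; apply: BkT; apply/seteqP.
- exact/FC/(decreasing_bigcup _ _ decB (CB _ FC) F0).
- by exists 0; rewrite B0.
- exact: (decreasing_stationary_minimal _ _ _ decB statB (CB _ DC) D0).
Qed.

Lemma retraction_decreasing kappa s m n : retraction kappa -> m <= n ->
  Mods1 (iter n kappa s) `<=` Mods1 (iter m kappa s).
Proof.
move=> kappaP /subnK <-; elim: (n - m) => //= k IHk.
apply: subset_trans IHk; set u := iter _ kappa s.
by case: (pselect (tautology u)) => [->|/kappaP[]].
Qed.

Lemma retraction_stationary kappa s : retraction kappa ->
  exists N, forall n, N <= n -> Mods1 (iter n kappa s) = Mods1 (iter N kappa s).
Proof.
move=> kappaP; case: (pselect (forall k, tautology (iter k kappa s))) => [tautT|].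
  by exists 0 => n _; rewrite !tautT.
(* Vacuum is applied to the [k]-th iterate, as [s] itself may be a tautology; [Triv] is thus reached
   at index [j + k]. *)
move=> /existsNP [k /kappaP [_ [j]]]; rewrite -iterD => jkT.
exists (j + k) => n len; apply/seteqP; split; first exact: retraction_decreasing.
by rewrite jkT; apply: Triv_sub_Mods1.
Qed.

End Retractions.

Theorem proposition2 (R : satisfaction_system)
    (conj : sentence R -> sentence R -> sentence R)
    (conjP : is_conjunction conj)
    (kappa : sentence R -> sentence R) (kappaP : retraction kappa)
    (T : set (sentence R)) (KB : knowledge_base T)
    (phi : sentence R) (consT : consistent (T `|` [set phi]))
    (t : sentence R) (tP : is_bigconj conj T t) :
  cutting T phi (C_lcr conj kappa t phi) /\
  cutting T phi (C_lnr conj kappa t phi).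
Proof.
have top : Mods1 (conj t phi) = Mods (T `|` [set phi]).
  by rewrite conjP ModsU1 (Mods1_bigconj _ _ _ conjP tP).
split.
  have [N statN] := retraction_stationary kappa t kappaP.
  (* Intersecting with the fixed set [Mods1 phi] preserves both monotonicity and stationarity. *)
  apply: (decreasing_stationary_cutting _ _
    (fun k => Mods1 (conj (iter k kappa t) phi)) N)
    => // [m n lemn|n leNn|n]; last exact: Triv_sub_Mods1.
  - by rewrite !conjP; apply: setSI; apply: retraction_decreasing.
  - by rewrite !conjP statN.
have [N statN] := retraction_stationary kappa (conj t phi) kappaP.
apply: (decreasing_stationary_cutting _ _
    (fun k => Mods1 (iter k kappa (conj t phi))) N)
  => // [m n lemn|n]; last exact: Triv_sub_Mods1.
exact: retraction_decreasing.
Qed.
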